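(* Let $\pi$ be an $\mathbb F_q$-subplane of $\Gamma$ (corresponding to an $\mathbb F_q$-subplane $\bar\pi$ of $\mathrm{PG}(2,q^3)$), let $\mathsf c_\pi$ be as in the context, and let $\mathcal V([\pi])$ denote the Segre variety $\mathcal S_{2;2}$ of $\mathrm{PG}(8,q)$ whose point set is the set of points on the planes $[X]$, $X\in\pi$. For $X\in\Gamma^{\bigstar}$ put \[(\!(X)\!)_\pi=\big\langle X,\ (X^{\mathsf c_\pi^5})^q,\ (X^{\mathsf c_\pi^4})^{q^2}\big\rangle=\big\langle X,\ (X^{\mathsf c_\pi^2\mathsf e})^q,\ (X^{\mathsf c_\pi\mathsf e})^{q^2}\big\rangle,\] which for $X\in\Gamma$ equals $\langle X,(X^{\mathsf c_\pi^2})^q,(X^{\mathsf c_\pi})^{q^2}\rangle$. Then (1) in $\mathrm{PG}(8,q^3)$, $\mathcal V([\pi])^\star$ is a Segre variety having as one system of maximal spaces the planes $\{(\!(X)\!)_\pi : X\in\Gamma\}$; (2) in $\mathrm{PG}(8,q^6)$, $\mathcal V([\pi])^{\bigstar}$ is a Segre variety having as one system of maximal spaces the planes $\{(\!(X)\!)_\pi : X\in\Gamma^{\bigstar}\}$.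
   Context: $q$ is a prime power; $\tau$ is a primitive element of $\mathbb F_{q^3}$. $\mathrm{PG}(8,q)\subset\mathrm{PG}(8,q^3)\subset\mathrm{PG}(8,q^6)$; for a point $X=(x_0,\dots,x_8)$, $X^q=(x_0^q,\dots,x_8^q)$, and $\mathsf e$ is the involution $X\mapsto X^{q^3}$ of $\mathrm{PG}(8,q^6)$ fixing $\mathrm{PG}(8,q^3)$ pointwise. Set $\mathsf a_0=-\tau^q\tau^{q^2}$, $\mathsf a_1=\tau^q+\tau^{q^2}$, $\mathsf a_2=-1$, $A_0=(\mathsf a_0,\mathsf a_1,\mathsf a_2,0,\dots,0)$, $A_1=(0,0,0,\mathsf a_0,\mathsf a_1,\mathsf a_2,0,0,0)$, $A_2=(0,\dots,0,\mathsf a_0,\mathsf a_1,\mathsf a_2)$; $\Gamma=\langle A_0,A_1,A_2\rangle$ is a transversal plane of the Bose $2$-spread of $\mathrm{PG}(8,q)$, whose planes are $[X]=\langle X,X^q,X^{q^2}\rangle\cap\mathrm{PG}(8,q)$, $X\in\Gamma$; the point $(x,y,z)$ of $\mathrm{PG}(2,q^3)$ corresponds to $xA_0+yA_1+zA_2\in\Gamma$. $\Gamma^{\bigstar}=\{xA_0+yA_1+zA_2: x,y,z\in\mathbb F_{q^6}\}$. $\mathsf c_\pi$ is the unique collineation of $\Gamma$ of order $3$ fixing $\pi$ pointwise of the form $xA_0+yA_1+zA_2\mapsto x'A_0+y'A_1+z'A_2$ with $(x',y',z')^T=B(x^q,y^q,z^q)^T$ for a nonsingular $3\times 3$ matrix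 $B$ over $\mathbb F_{q^3}$ (e.g. for $\pi$ corresponding to $\mathrm{PG}(2,q)$, $B=I$); by the same formula it extends to a collineation of $\Gamma^{\bigstar}$ of order $6$. Segre variety: image of $\mathrm{PG}(2)\times\mathrm{PG}(2)$ under the Segre map, up to projectivity; ${}^\star$, ${}^{\bigstar}$ denote the variety-extensions to $\mathrm{PG}(8,q^3)$, $\mathrm{PG}(8,q^6)$ (points over the larger field satisfying the same defining equations over $\mathbb F_q$). *)

(* Defs.v *)
From HB Require Import structures.
From mathcomp Require Import all_boot all_order all_algebra.
From mathcomp Require Import mpoly.

Set Implicit Arguments.
Unset Strict Implicit.
Unset Printing Implicit Defensive.

Import GRing.Theory.
Local Open Scope ring_scope.

(* Subspaces of PG(8, K) are the linear subspaces of 'rV[K]_9; the point with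
   homogeneous coordinates x != 0 is <[x]>.  Points of PG(2, K) are the lines
   <[x]> of 'cV[K]_3 (columns, since collineations are written x |-> B x^q). *)

Definition same_elements (T : Type) (A B : T -> Prop) : Prop :=
  forall t, A t <-> B t.

Section Varieties.
Variables (F K : fieldType) (iota : {rmorphism F -> K}).

(* The points of PG(8, K) satisfying the homogeneous equations E, whose
   coefficients lie in F and are read in K through iota. *)
Definition zero_locus (E : {mpoly F[9]} -> Prop) (P : {vspace 'rV[K]_9}) :=
  exists2 x : 'rV[K]_9, x != 0 &
    P = <[x]>%VS /\ forall f, E f -> mmap iota (x 0) f = 0.

End Varieties.

Section Segre.
Variable K : fieldType.

(* (u, v) |-> (u_0 v_0, u_0 v_1, u_0 v_2, u_1 v_0, ..., u_2 v_2) *)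
Definition segre_map (u v : 'rV[K]_3) : 'rV[K]_9 := @mxvec K 3 3 (u^T *m v).

(* Image of PG(2, K) x PG(2, K) under the Segre map followed by the
   projectivity x |-> x g. *)
Definition segre_points (g : 'M[K]_9) (P : {vspace 'rV[K]_9}) : Prop :=
  exists u v : 'rV[K]_3,
    [/\ u != 0, v != 0 & P = <[segre_map u v *m g]>%VS].

Definition segre_system1 (g : 'M[K]_9) (U : {vspace 'rV[K]_9}) : Prop :=
  exists2 u : 'rV[K]_3, u != 0 &
    forall w, w \in U <-> exists v, w = segre_map u v *m g.

Definition segre_system2 (g : 'M[K]_9) (U : {vspace 'rV[K]_9}) : Prop :=
  exists2 v : 'rV[K]_3, v != 0 &
    forall w, w \in U <-> exists u, w = segre_map u v *m g.

Definition is_segre (S : {vspace 'rV[K]_9} -> Prop) : Prop :=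
  exists2 g : 'M[K]_9, g \in unitmx & same_elements S (segre_points g).

Definition is_segre_with_system (S Pi : {vspace 'rV[K]_9} -> Prop) : Prop :=
  exists2 g : 'M[K]_9, g \in unitmx &
    same_elements S (segre_points g) /\
    (same_elements Pi (segre_system1 g) \/ same_elements Pi (segre_system2 g)).

(* The linear form giving the (a, b) entry of the 3 x 3 matrix x g^-1, and the
   2 x 2 minors of that matrix: these are the equations of segre_points g. *)
Definition segre_entry (g : 'M[K]_9) (a b : 'I_3) : {mpoly K[9]} :=
  \sum_(t < 9) invmx g t (@mxvec_index 3 3 a b) *: 'X_t.

Definition segre_equations (g : 'M[K]_9) (f : {mpoly K[9]}) : Prop :=
  exists i j k l : 'I_3,
    f = segre_entry g i j * segre_entry g k l
      - segre_entry g i l * segre_entry g k j.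

End Segre.

(* X |-> X^m on coordinates *)
Definition frob (K : fieldType) (m r n : nat) (X : 'M[K]_(r, n)) : 'M[K]_(r, n) :=
  map_mx (fun t => t ^+ m) X.

Section Gamma.
Variables (K : fieldType) (q : nat) (tau : K).

Definition ga0 : K := - (tau ^+ q * tau ^+ (q ^ 2)).
Definition ga1 : K := tau ^+ q + tau ^+ (q ^ 2).
Definition ga2 : K := -1.

Definition vec9 (s : seq K) : 'rV[K]_9 := \row_(k < 9) s`_k.

Definition gA0 : 'rV[K]_9 := vec9 [:: ga0; ga1; ga2; 0; 0; 0; 0; 0; 0].
Definition gA1 : 'rV[K]_9 := vec9 [:: 0; 0; 0; ga0; ga1; ga2; 0; 0; 0].
Definition gA2 : 'rV[K]_9 := vec9 [:: 0; 0; 0; 0; 0; 0; ga0; ga1; ga2].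

(* (x, y, z)^T |-> x A_0 + y A_1 + z A_2; its nonzero values are the points of
   Gamma when K = F_(q^3), and of its extension when K = F_(q^6). *)
Definition gamma (x : 'cV[K]_3) : 'rV[K]_9 :=
  x (inord 0) 0 *: gA0 + x (inord 1) 0 *: gA1 + x (inord 2) 0 *: gA2.

Variable B : 'M[K]_3.

(* The semilinear map (x, y, z)^T |-> B (x^q, y^q, z^q)^T *)
Definition coll (x : 'cV[K]_3) : 'cV[K]_3 := B *m frob q x.

(* X^(c^k) for X = gamma x *)
Definition cpow (k : nat) (x : 'cV[K]_3) : 'rV[K]_9 := gamma (iter k coll x).

(* < X, (X^(c^5))^q, (X^(c^4))^(q^2) > *)
Definition bplane (x : 'cV[K]_3) : {vspace 'rV[K]_9} :=
  <<[:: gamma x; frob q (cpow 5 x); frob (q ^ 2) (cpow 4 x)]>>%VS.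

(* < X, (X^(c^2 e))^q, (X^(c e))^(q^2) >, with e : X |-> X^(q^3) *)
Definition bplane_e (x : 'cV[K]_3) : {vspace 'rV[K]_9} :=
  <<[:: gamma x; frob q (frob (q ^ 3) (cpow 2 x));
        frob (q ^ 2) (frob (q ^ 3) (cpow 1 x))]>>%VS.

(* < X, (X^(c^2))^q, (X^c)^(q^2) > *)
Definition bplane_cubic (x : 'cV[K]_3) : {vspace 'rV[K]_9} :=
  <<[:: gamma x; frob q (cpow 2 x); frob (q ^ 2) (cpow 1 x)]>>%VS.

Definition bplanes (U : {vspace 'rV[K]_9}) : Prop :=
  exists2 x : 'cV[K]_3, x != 0 & U = bplane x.

(* f, a map on nonzero vectors inducing a collineation, has order n as a
   permutation of the points of the plane. *)
Definition point_order (f : 'cV[K]_3 -> 'cV[K]_3) (n : nat) : Prop :=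
  [/\ (0 < n)%N,
      forall x, x != 0 -> <[iter n f x]>%VS = <[x]>%VS
    & forall k, (0 < k < n)%N ->
        exists2 x, x != 0 & <[iter k f x]>%VS <> <[x]>%VS].

(* The collineation c_pi, given by its matrix B *)
Definition is_cpi (pi : {vspace 'cV[K]_3} -> Prop) : Prop :=
  [/\ B \in unitmx,
      point_order coll 3
    & forall x, x != 0 -> pi <[x]>%VS -> <[coll x]>%VS = <[x]>%VS].

End Gamma.

Section Bose.
Variables (F K : fieldType) (iota : {rmorphism F -> K}) (q : nat) (tau : K).

(* pi is the image of PG(2, F) under a projectivity of PG(2, K). *)
Definition is_subplane (pi : {vspace 'cV[K]_3} -> Prop) : Prop :=
  exists2 g : 'M[K]_3, g \in unitmx &
    forall P, pi P <-> exists2 y : 'cV[F]_3, y != 0 &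
                         P = <[g *m map_mx iota y]>%VS.

(* The points of [X] = < X, X^q, X^(q^2) > meet PG(8, F) *)
Definition spread_plane (X : 'rV[K]_9) (P : {vspace 'rV[F]_9}) : Prop :=
  exists2 y : 'rV[F]_9, y != 0 &
    P = <[y]>%VS /\ map_mx iota y \in <<[:: X; frob q X; frob (q ^ 2) X]>>%VS.

(* The points on the planes [X], for X in the subplane of Gamma corresponding
   to pi *)
Definition Vpi (pi : {vspace 'cV[K]_3} -> Prop) (P : {vspace 'rV[F]_9}) : Prop :=
  exists x : 'cV[K]_3,
    [/\ x != 0, pi <[x]>%VS & spread_plane (gamma q tau x) P].

End Bose.

(* Main.v *)
Require Import Defs.
From HB Require Import structures.
From mathcomp Require Import all_boot all_order all_algebra.
From mathcomp Require Import all_fingroup all_solvable all_field.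
From mathcomp Require Import ring.
From mathcomp Require Import mpoly.

(* Write the subplane as h PG(2, q).  Since c_pi fixes it pointwise, B h^(q) is
   a multiple of h, so that for X = h z the plane ((X)) is spanned by the three
   tensors h^(q^m) z (x) a^(q^m), m = 0, 1, 2, with a = (a_0, a_1, a_2).
   As a_0 + a_1 x + a_2 x^2 = - (x - tau^q) (x - tau^(q^2)), the columns
   t^(q^m), t = (1, tau, tau^2)^T, are up to scalars dual to the rows a^(q^m).
   Hence
     (u, v) |-> sum_m (v t^(q^m)) (h^(q^m) u^T) (x) a^(q^m)
   is the Segre map followed by an invertible matrix.  That matrix is a trace,
   so it has entries in F_q, and over F_q its image is V([pi]).
   Finally, a Segre variety over F_q is determined over every extension by its
   F_q-points: 2 x 2 minors pulled back by the Segre map are quadratic forms in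
   each argument, and a quadratic form that vanishes at all e_i and e_i + e_j
   is zero. *)

Set Implicit Arguments.
Unset Strict Implicit.
Unset Printing Implicit Defensive.

Import GRing.Theory.
Local Open Scope ring_scope.

(** * Rank-one matrices and their 2 x 2 minors *)

Section RankOne.
Variable K : fieldType.

Definition minors_vanish (N : 'M[K]_3) : Prop :=
  forall i j k l, N i j * N k l - N i l * N k j = 0.

Lemma minors_vanish_outer (c : 'cV[K]_3) (r : 'rV[K]_3) :
  minors_vanish (c *m r).
Proof. by move=> i j k l; rewrite !mxE !big_ord1; ring. Qed.

Lemma minors_vanish0 : minors_vanish 0.
Proof. by move=> i j k l; rewrite !mxE; ring. Qed.

Lemma minors_vanishZ (a : K) (N : 'M[K]_3) :
  minors_vanish N -> minors_vanish (a *: N).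
Proof.
move=> h i j k l; transitivity (a ^+ 2 * (N i j * N k l - N i l * N k j)).
  by rewrite !mxE; ring.
by rewrite h mulr0.
Qed.

(** A nonzero entry [N i j] serves as pivot: the minor through it reads
    [N i j * N k l = N i l * N k j], so column [j] times the rescaled row [i] recovers [N]. *)
Lemma minors_vanish_factor (N : 'M[K]_3) :
  minors_vanish N -> exists (c : 'cV[K]_3) (r : 'rV[K]_3), N = c *m r.
Proof.
move=> hN; have [->|/matrix0Pn[i [j Nij]]] := eqVneq N 0.
  by exists 0, 0; rewrite mul0mx.
exists (col j N), ((N i j)^-1 *: row i N); apply/matrixP => k l.
rewrite !mxE big_ord1 !mxE; apply: (mulfI Nij).
by have /eqP := hN i j k l; rewrite subr_eq0 => /eqP ->; field.
Qed.

(** Each minor is a quadratic form [m], and [m (A + B) - m A - m B] is its polar form, so the six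
    values in the hypotheses determine it on the span of [A], [B], [C]. *)
Lemma minors_vanish_comb3 (A B C : 'M[K]_3) (x y z : K) :
    minors_vanish A -> minors_vanish B -> minors_vanish C ->
    minors_vanish (A + B) -> minors_vanish (A + C) -> minors_vanish (B + C) ->
  minors_vanish (x *: A + y *: B + z *: C).
Proof.
move=> hA hB hC hAB hAC hBC i j k l.
pose m (N : 'M[K]_3) := N i j * N k l - N i l * N k j.
have -> : (x *: A + y *: B + z *: C) i j * (x *: A + y *: B + z *: C) k l
    - (x *: A + y *: B + z *: C) i l * (x *: A + y *: B + z *: C) k j
  = x ^+ 2 * m A + y ^+ 2 * m B + z ^+ 2 * m C
    + x * y * (m (A + B) - m A - m B) + x * z * (m (A + C) - m A - m C)
    + y * z * (m (B + C) - m B - m C).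
  by rewrite /m !mxE; ring.
by rewrite /m hA hB hC hAB hAC hBC !subr0 !mulr0 !addr0.
Qed.

(** The test vectors have coordinates in the prime field, hence are defined over every subfield;
    this is what allows descent from [K] to [F]. *)
Lemma minors_vanish_linear (f : {linear 'rV[K]_3 -> 'M[K]_3}) :
    (forall i, minors_vanish (f (delta_mx 0 i))) ->
    (forall i j, minors_vanish (f (delta_mx 0 i + delta_mx 0 j))) ->
  forall u, minors_vanish (f u).
Proof.
move=> f1 f2 u; rewrite (row_sum_delta u) linear_sum.
rewrite !big_ord_recl big_ord0 addr0 addrA !linearZ.
by apply: minors_vanish_comb3; rewrite -?linearD.
Qed.

End RankOne.

(** * Segre points as nonzero vectors with vanishing minors *)

Section SegreCone.
Variable K : fieldType.
Implicit Types (u v : 'rV[K]_3) (g : 'M[K]_9).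

Definition unsegre (x : 'rV[K]_9) : 'M[K]_3 := @vec_mx K 3 3 x.

Lemma unsegreK (u v : 'rV[K]_3) : unsegre (segre_map u v) = u^T *m v.
Proof. exact: mxvecK. Qed.

Lemma segre_map_neq0 u v g : g \in unitmx -> u != 0 -> v != 0 ->
  segre_map u v *m g != 0.
Proof.
move=> gU /rV0Pn[i ui] /rV0Pn[j vj]; apply/eqP => /(canRL (mulmxK gU)).
rewrite mul0mx => /(congr1 unsegre)/matrixP/(_ i j); rewrite unsegreK.
by rewrite !mxE big_ord1 !mxE => /eqP; rewrite mulf_eq0 (negPf ui) (negPf vj).
Qed.

(** Passes from the parametric description to the equations: undoing [g] and reading the vector as a
    3 x 3 matrix, decomposable means of rank one. *)
Lemma segre_pointsP g (P : {vspace 'rV[K]_9}) : g \in unitmx ->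
  segre_points g P <->
  exists2 x : 'rV[K]_9, x != 0 &
    P = <[x]>%VS /\ minors_vanish (unsegre (x *m invmx g)).
Proof.
move=> gU; split=> [[u [v [u0 v0 ->]]]|[x x0 [-> /minors_vanish_factor]]].
  exists (segre_map u v *m g); first exact: segre_map_neq0.
  by rewrite mulmxK // unsegreK; split=> //; apply: minors_vanish_outer.
case=> c [r /(congr1 mxvec)]; rewrite vec_mxK => /(canRL (mulmxKV gU)) xE.
exists c^T, r; rewrite /segre_map trmxK -xE; split=> //.
  by apply: contraNneq x0 => /eqP; rewrite trmx_eq0 => /eqP c0;
    rewrite xE c0 mul0mx raddf0 mul0mx.
by apply: contraNneq x0 => r0; rewrite xE r0 mulmx0 raddf0 mul0mx.
Qed.

(** The arguments are swapped so that linearity in the first factor can be registered as an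
    instance. *)
Definition segre_mapr v u : 'rV[K]_9 := segre_map u v.

Lemma segre_mapr_is_linear v : linear (segre_mapr v).
Proof.
move=> a u u'; rewrite /segre_mapr /segre_map !linearP /= mulmxDl -scalemxAl.
by rewrite linearP.
Qed.

Lemma segre_map_is_linear u : linear (segre_map u).
Proof. by move=> a v v'; rewrite /segre_map !linearP. Qed.

HB.instance Definition _ v := GRing.isLinear.Build K 'rV[K]_3 'rV[K]_9 _
  (segre_mapr v) (segre_mapr_is_linear v).
HB.instance Definition _ u := GRing.isLinear.Build K 'rV[K]_3 'rV[K]_9 _
  (segre_map u) (segre_map_is_linear u).
HB.instance Definition _ := GRing.isLinear.Build K 'rV[K]_9 'M[K]_3 _
  unsegre (@linearP _ _ _ _ (@vec_mx K 3 3)).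

End SegreCone.

(** * A Segre variety over a field extension is determined by its points over the small field *)

Section Descent.
Variables (F K : fieldType) (iota : {rmorphism F -> K}).

Lemma unsegre_map (x : 'rV[F]_9) :
  unsegre (map_mx iota x) = map_mx iota (unsegre x).
Proof. by rewrite /unsegre map_vec_mx. Qed.

Lemma segre_map_map (u v : 'rV[F]_3) :
  segre_map (map_mx iota u) (map_mx iota v) = map_mx iota (segre_map u v).
Proof.
rewrite /segre_map map_trmx -map_mxM.
exact: esym (@map_mxvec _ _ iota 3 3 _).
Qed.

Lemma minors_vanish_map (N : 'M[F]_3) :
  minors_vanish N -> minors_vanish (map_mx iota N).
Proof. by move=> h i j k l; rewrite !mxE -!rmorphM -rmorphB h rmorph0. Qed.

(** The two arguments are extended from [F] to [K] one after the other: first [u] with [v] still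
    over [F], then [v]. *)
Lemma minors_vanish_unsegre_ext (phi : 'M[F]_9) :
    (forall u v : 'rV[F]_3, minors_vanish (unsegre (segre_map u v *m phi))) ->
  forall u v, minors_vanish (unsegre (segre_map u v *m map_mx iota phi)).
Proof.
move=> h.
have hF (u v : 'rV[F]_3) : minors_vanish
    (unsegre (segre_map (map_mx iota u) (map_mx iota v) *m map_mx iota phi)).
  by rewrite segre_map_map -map_mxM unsegre_map; apply/minors_vanish_map/h.
have hu u (v : 'rV[F]_3) :
    minors_vanish (unsegre (segre_map u (map_mx iota v) *m map_mx iota phi)).
  pose f : 'rV_3 -> 'M_3 :=
    @unsegre K \o mulmxr (map_mx iota phi) \o segre_mapr (map_mx iota v).
  apply: (minors_vanish_linear (f := f)) => [i|i j].
    by rewrite -(map_delta_mx iota); apply: hF.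
  by rewrite -!(map_delta_mx iota) -map_mxD; apply: hF.
move=> u v.
pose f : 'rV_3 -> 'M_3 := @unsegre K \o mulmxr (map_mx iota phi) \o segre_map u.
apply: (minors_vanish_linear (f := f)) => [i|i j].
  by rewrite -(map_delta_mx iota); apply: hu.
by rewrite -!(map_delta_mx iota) -map_mxD; apply: hu.
Qed.

(** Inclusion over [F] says that the minors vanish on the Segre map followed by [g *m invmx g'];
    this identity extends to [K]. *)
Lemma segre_points_map_sub (g g' : 'M[F]_9) : g \in unitmx -> g' \in unitmx ->
    (forall P, segre_points g P -> segre_points g' P) ->
  forall P, segre_points (map_mx iota g) P -> segre_points (map_mx iota g') P.
Proof.
move=> gU g'U sub P [u [v [u0 v0 PE]]].
have ext : forall u v, minors_vanish
    (unsegre (segre_map u v *m map_mx iota (g *m invmx g'))).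
  apply: minors_vanish_unsegre_ext => x y.
  (* Zero arguments give no projective point, so the inclusion says nothing about them; there the
     image is 0. *)
  have [->|x0] := eqVneq x 0.
    rewrite -[segre_map 0 y]/(segre_mapr y 0) !(linear0, mul0mx).
    exact: minors_vanish0.
  have [->|y0] := eqVneq y 0.
    by rewrite !(linear0, mul0mx); apply: minors_vanish0.
  have /(segre_pointsP _ g'U)[w w0 [xE hx]] :
    segre_points g' <[segre_map x y *m g]>%VS by apply: sub; exists x, y.
  have /vlineP[k kE] : segre_map x y *m g \in <[w]>%VS by rewrite -xE memv_line.
  rewrite mulmxA kE -scalemxAl linearZ; exact: minors_vanishZ hx.
have gU' : map_mx iota g' \in unitmx by rewrite map_unitmx.
apply/(segre_pointsP _ gU'); exists (segre_map u v *m map_mx iota g).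
  by apply: segre_map_neq0; rewrite ?map_unitmx.
by split=> //; rewrite -map_invmx -mulmxA -map_mxM.
Qed.

Lemma zero_locus_segreP (g : 'M[F]_9) (P : {vspace 'rV[K]_9}) :
  g \in unitmx ->
  zero_locus iota (segre_equations g) P <-> segre_points (map_mx iota g) P.
Proof.
move=> gU; have gU' : map_mx iota g \in unitmx by rewrite map_unitmx.
have entryE (x : 'rV[K]_9) a b : mmap iota (x 0) (segre_entry g a b)
    = unsegre (x *m invmx (map_mx iota g)) a b.
  rewrite /segre_entry raddf_sum !mxE /=; apply: eq_bigr => t _.
  by rewrite mmapZ mmapX mmap1U -map_invmx !mxE mulrC.
have eqsE (x : 'rV[K]_9) :
    (forall f, segre_equations g f -> mmap iota (x 0) f = 0)
    <-> minors_vanish (unsegre (x *m invmx (map_mx iota g))).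
  split=> [h i j k l|h f [i [j [k [l ->]]]]].
    by rewrite -!entryE -!rmorphM -rmorphB; apply: h; exists i, j, k, l.
  by rewrite rmorphB !rmorphM /= !entryE.
apply: iff_trans (iff_sym (segre_pointsP _ gU')).
by split=> -[x x0 [-> /eqsE h]]; exists x.
Qed.

End Descent.

(** * Tensor coordinates for Gamma and the trace matrix *)

Lemma val_mxvec_index3 (i j : 'I_3) :
  (mxvec_index i j : 'I_(3 * 3)) = (3 * i + j)%N :> nat.
Proof.
(* Pairs are enumerated lexicographically, so [mxvec] lists a matrix row by row, matching the three
   blocks of [gA0], [gA1], [gA2]. *)
have E : enum {: 'I_3 * 'I_3} =
  [seq (x, y) | x <- enum 'I_3, y <- enum 'I_3].
  by rewrite enumT unlock.
rewrite /mxvec_index /= /enum_rank [enum_rank_in]unlock insubdK; last first.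
  by rewrite unfold_in cardE index_mem mem_enum.
rewrite E !(enum_ordSl, enum_ord0) /=.
by case: i j => [[|[|[|]]]] // ? [[|[|[|]]]].
Qed.

Section Frame.
Variable K : fieldType.

Definition row_a (q : nat) (tau : K) : 'rV[K]_3 :=
  \row_(j < 3) [:: ga0 q tau; ga1 q tau; ga2 K]`_j.

(** The points of Gamma are the pure tensors with second factor [row_a]. *)
Lemma gammaE q tau (x : 'cV[K]_3) :
  gamma q tau x = @mxvec K 3 3 (x *m row_a q tau).
Proof.
apply/rowP => k; case/(@mxvec_indexP 3 3): k => i j.
apply: etrans (esym (mxvecE _ i j)).
rewrite !mxE big_ord1 !mxE val_mxvec_index3.
have -> : inord 0 = 0 :> 'I_3 by apply: val_inj; rewrite /= inordK.
have -> : inord 1 = 1 :> 'I_3 by apply: val_inj; rewrite /= inordK.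
have -> : inord 2 = 2%:R :> 'I_3 by apply: val_inj; rewrite /= inordK.
by case: i j => [[|[|[|]]]] // p [[|[|[|]]]] // r;
  rewrite /= !(mulr0, add0r, addr0); congr (x _ _ * _); apply/val_inj.
Qed.

Definition col_t (tau : K) : 'cV[K]_3 := \col_(i < 3) tau ^+ i.

(** Acting on row vectors, this is the matrix of N -> sum_m h^(q^m) N (t a)^(q^m) on vectorised
    matrices N, with t = [col_t tau] and a = [row_a q tau]. *)
Definition segre_frame (q : nat) (tau : K) (h : 'M[K]_3) : 'M[K]_9 :=
  \sum_(m < 3) lin_mulmx (frob (q ^ m) h)
     *m lin_mulmxr (frob (q ^ m) (col_t tau *m row_a q tau)).

(** The Frobenius power acts on [h] and [row_a] but not on [z]: these are the spanning tensors of
    ((X)) for X = h z. *)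
Definition plane_gen (q : nat) (tau : K) (h : 'M[K]_3) (m : nat) (z : 'cV[K]_3)
    : 'rV[K]_9 :=
  @mxvec K 3 3 (frob (q ^ m) h *m z *m frob (q ^ m) (row_a q tau)).

Lemma vlineZ (V : vectType K) (a : K) (v : V) :
  a != 0 -> <[a *: v]>%VS = <[v]>%VS.
Proof.
move=> a0; apply/eqP; rewrite eqEsubv -!memvE memvZ ?memv_line //.
by apply/vlineP; exists a^-1; rewrite scalerA mulVf // scale1r.
Qed.

Lemma mem_span3P (V : vectType K) (u v w x : V) :
  x \in <<[:: u; v; w]>>%VS <->
  exists a b c : K, x = a *: u + b *: v + c *: w.
Proof.
rewrite !span_cons span_nil addv0; split=> [|[a [b [c ->]]]].
  case/memv_addP => _ /vlineP[a ->] [_ /memv_addP[_ /vlineP[b ->]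
    [_ /vlineP[c ->] ->]] ->].
  by exists a, b, c; rewrite addrA.
by rewrite -addrA !memv_add // memvZ // memv_line.
Qed.

Lemma eq_span3 (V : vectType K) (u v w : V) (a b : K) : a != 0 -> b != 0 ->
  <<[:: u; a *: v; b *: w]>>%VS = <<[:: u; v; w]>>%VS.
Proof. by move=> a0 b0; rewrite !span_cons span_nil !vlineZ. Qed.

(** Packing the power map as a ring morphism makes the [map_mx] lemmas available for [frob]. *)
Lemma exists_frobenius m : [pchar K].-nat m ->
  {s : {rmorphism K -> K} | forall x, s x = x ^+ m}.
Proof.
move=> hm; pose f (x : K) := x ^+ m.
have fD : nmod_morphism f.
  split; last by move=> x y; apply: exprDn_pchar.
  by case/andP: hm => m0 _; rewrite /f expr0n gtn_eqF.
have fM : monoid_morphism f.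
  by split=> [|x y]; rewrite /f ?expr1n ?exprMn.
pose N := GRing.isNmodMorphism.Build K K f fD.
pose M := GRing.isMonoidMorphism.Build K K f fM.
by exists (HB.pack f N M : {rmorphism K -> K}).
Qed.

End Frame.

(** * Compatibility with field embeddings *)

Section FrobMap.
Variables (F K : fieldType) (iota : {rmorphism F -> K}).

Lemma map_frob m r n (X : 'M[F]_(r, n)) :
  map_mx iota (frob m X) = frob m (map_mx iota X).
Proof. by apply/matrixP => i j; rewrite !mxE rmorphXn. Qed.

Lemma map_row_a q tau : map_mx iota (row_a q tau) = row_a q (iota tau).
Proof.
apply/rowP => j; rewrite !mxE.
by case: j => [[|[|[|]]]] //= _;
  rewrite /ga0 /ga1 /ga2 ?(rmorphN, rmorphM, rmorphD, rmorphXn, rmorph1).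
Qed.

Lemma map_col_t tau : map_mx iota (col_t tau) = col_t (iota tau).
Proof. by apply/colP => j; rewrite !mxE rmorphXn. Qed.

Lemma map_segre_frame q tau h :
  map_mx iota (segre_frame q tau h)
  = segre_frame q (iota tau) (map_mx iota h).
Proof.
rewrite /segre_frame raddf_sum; apply: eq_bigr => m _ /=.
rewrite map_mxM; congr (_ *m _).
  by apply: (@map_lin_mx _ _ iota 3 3 3 3) => A; rewrite map_mxM map_frob.
apply: (@map_lin_mx _ _ iota 3 3 3 3) => A.
by rewrite /= map_mxM map_frob map_mxM map_row_a map_col_t.
Qed.

End FrobMap.

(** * Duality of the conjugates of [row_a] and [col_t], and invertibility of the trace matrix *)

Section Twist.
Variables (K : fieldType) (q : nat).
Hypothesis q_pchar : [pchar K].-nat q.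

Lemma frobD m n r c (X : 'M[K]_(r, c)) :
  frob (q ^ m) (frob (q ^ n) X) = frob (q ^ (n + m)) X.
Proof. by apply/matrixP => i j; rewrite !mxE expnD exprM. Qed.

Lemma frob0 r c (X : 'M[K]_(r, c)) : frob (q ^ 0) X = X.
Proof. by apply/matrixP => i j; rewrite !mxE. Qed.

Lemma frob_rmorph m :
  {s : {rmorphism K -> K} | (forall x, s x = x ^+ (q ^ m)) &
     forall r c (X : 'M[K]_(r, c)), frob (q ^ m) X = map_mx s X}.
Proof.
have /exists_frobenius[s sE] : [pchar K].-nat (q ^ m)%N.
  by rewrite pnatX q_pchar.
by exists s => // r c X; apply/matrixP => i j; rewrite !mxE sE.
Qed.

Lemma frobMmx m r c p (X : 'M[K]_(r, c)) (Y : 'M[K]_(c, p)) :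
  frob (q ^ m) (X *m Y) = frob (q ^ m) X *m frob (q ^ m) Y.
Proof. by have [s _ sE] := frob_rmorph m; rewrite !sE map_mxM. Qed.

Lemma frobZ m r c a (X : 'M[K]_(r, c)) :
  frob (q ^ m) (a *: X) = a ^+ (q ^ m) *: frob (q ^ m) X.
Proof. by apply/matrixP => i j; rewrite !mxE exprMn. Qed.

Variables (tau : K) (h : 'M[K]_3).
Hypotheses (h_unit : h \in unitmx) (h_frob3 : frob (q ^ 3) h = h).
Hypotheses (tau_frob3 : tau ^+ (q ^ 3) = tau) (tau_frob1 : tau ^+ q != tau).

Lemma row_a_frob3 : frob (q ^ 3) (row_a q tau) = row_a q tau.
Proof.
by have [s sE ->] := frob_rmorph 3; rewrite map_row_a sE tau_frob3.
Qed.

Lemma plane_gen_add3 m z : plane_gen q tau h (m + 3) z = plane_gen q tau h m z.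
Proof. by rewrite /plane_gen addnC -!frobD h_frob3 row_a_frob3. Qed.

Let b (i : nat) : K := tau ^+ (q ^ i).
Let d (i : nat) : K := - ((b i - b i.+1) * (b i - b i.+2)).

(** Coefficients of -(X - y)(X - z), constant term first, so multiplying by [col_t x] evaluates at
    [x]. *)
Definition row_quad (y z : K) : 'rV[K]_3 :=
  \row_(j < 3) [:: - (y * z); y + z; -1]`_j.

Lemma row_quad_mul_col_t x y z :
  row_quad y z *m col_t x = (- ((x - y) * (x - z)))%:M.
Proof.
apply/matrixP => i j; rewrite !ord1 !mxE !big_ord_recl big_ord0 !mxE /=.
ring.
Qed.

Lemma frob_row_a i : frob (q ^ i) (row_a q tau) = row_quad (b i.+1) (b i.+2).
Proof.
have [s sE ->] := frob_rmorph i.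
rewrite map_row_a sE; apply/rowP => -[[|[|[|]]]] // p; rewrite !mxE /=;
  by rewrite /ga0 /ga1 /b -?exprM -?expnSr -?expnD ?addn2.
Qed.

Lemma frob_col_t i : frob (q ^ i) (col_t tau) = col_t (b i).
Proof. by have [s sE ->] := frob_rmorph i; rewrite map_col_t sE. Qed.

Lemma b_add3 i : b i.+3 = b i.
Proof. by rewrite /b -addn3 addnC expnD exprM tau_frob3. Qed.

Lemma b_succ_neq i : b i != b i.+1.
Proof.
have [s sE _] := frob_rmorph i.
by rewrite /b expnS exprM -!sE fmorph_eq eq_sym.
Qed.

(** The i-th conjugate of [row_a] is a quadratic with roots [b i.+1] and [b i.+2]; as [b] has period
    3, it vanishes at [b j] for each [j] other than [i]. *)
Lemma row_a_mul_col_t (i j : 'I_3) :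
  frob (q ^ i) (row_a q tau) *m frob (q ^ j) (col_t tau) = (d i *+ (i == j))%:M.
Proof.
rewrite frob_row_a frob_col_t row_quad_mul_col_t; congr (_%:M).
by case: i j => [[|[|[|]]]] // p [[|[|[|]]]] // r;
  rewrite -?val_eqE /= ?b_add3 // /d ?b_add3;
  rewrite ?mulr1n ?mulr0n ?subrr ?(mul0r, mulr0) ?oppr0 ?b_add3.
Qed.

Lemma d_neq0 i : d i != 0.
Proof.
rewrite oppr_eq0 mulf_neq0 // subr_eq0 ?b_succ_neq //.
by rewrite -[b i]b_add3 eq_sym b_succ_neq.
Qed.

(** Duality says A T = 1 for the matrix A of rescaled rows and the matrix T of columns; for square
    matrices T A = 1 follows, which is this resolution of the identity. *)
Lemma sum_col_t_row_a :
  \sum_(i < 3) (d i)^-1 *: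
    (frob (q ^ i) (col_t tau) *m frob (q ^ i) (row_a q tau)) = 1.
Proof.
pose A := \matrix_(i < 3) ((d i)^-1 *: frob (q ^ i) (row_a q tau)).
pose T := \matrix_(k < 3, j < 3) frob (q ^ j) (col_t tau) k 0.
have colT j : col j T = frob (q ^ j) (col_t tau).
  by apply/colP => k; rewrite !mxE.
have /mulmx1C TA : A *m T = 1%:M.
  apply/row_matrixP => i; rewrite row_mul rowK.
  apply/rowP => j.
  transitivity ((((d i)^-1 *: frob (q ^ i) (row_a q tau)) *m col j T) 0 0).
    by rewrite !mxE; apply: eq_bigr => k _; rewrite !mxE.
  rewrite colT -scalemxAl row_a_mul_col_t !mxE eqxx.
  by have [_|_] := eqVneq i j; rewrite ?mulr0 // mulVf // d_neq0.
rewrite -[RHS]TA; apply/matrixP => k l; rewrite summxE !mxE.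
by apply: eq_bigr => i _; rewrite !mxE big_ord1 !mxE mulrCA.
Qed.

Lemma segre_frameE (N : 'M[K]_3) :
  (@mxvec K 3 3 N) *m segre_frame q tau h =
  \sum_(m < 3) @mxvec K 3 3 (frob (q ^ m) h *m N *m frob (q ^ m) (col_t tau)
                             *m frob (q ^ m) (row_a q tau)).
Proof.
rewrite /segre_frame mulmx_sumr; apply: eq_bigr => m _.
rewrite mulmxA; set A := frob _ h; set C := frob _ (_ *m _).
have -> : @mxvec K 3 3 N *m lin_mulmx A = @mxvec K 3 3 (A *m N) :> 'rV_9.
  exact: (mul_vec_lin (mulmx A : {linear 'M_3 -> 'M_3})).
transitivity (@mxvec K 3 3 (A *m N *m C)).
  exact: (mul_vec_lin (mulmxr C : {linear 'M_3 -> 'M_3})).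
by rewrite /C frobMmx !mulmxA.
Qed.

Lemma segre_map_frame (u c : 'rV[K]_3) :
  segre_map u c *m segre_frame q tau h =
  \sum_(m < 3) (c *m frob (q ^ m) (col_t tau)) 0 0 *: plane_gen q tau h m u^T.
Proof.
rewrite segre_frameE; apply: eq_bigr => m _.
have -> : frob (q ^ m) h *m (u^T *m c) *m frob (q ^ m) (col_t tau)
    *m frob (q ^ m) (row_a q tau)
  = (c *m frob (q ^ m) (col_t tau)) 0 0 *:
    (frob (q ^ m) h *m u^T *m frob (q ^ m) (row_a q tau)).
  rewrite -[X in X *m _]mulmxA -[u^T *m c *m _]mulmxA.
  by rewrite [in LHS](mx11_scalar (c *m _)) mul_mx_scalar -scalemxAr -scalemxAl.
by rewrite linearZ.
Qed.

(** If N is in the kernel, multiplying its image by the j-th conjugate of [col_t] isolates the j-th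
    summand. So N kills all three conjugates, and the resolution of the identity gives N = 0. *)
Lemma segre_frame_unit : segre_frame q tau h \in unitmx.
Proof.
rewrite -row_free_unit; apply: inj_row_free => v.
pose N := unsegre v; have -> : v = @mxvec K 3 3 N by rewrite vec_mxK.
rewrite segre_frameE -raddf_sum => /(congr1 (@unsegre K)).
rewrite /unsegre [LHS]mxvecK raddf0 => S0.
suff -> : N = 0 by rewrite raddf0.
rewrite -[N]mulmx1 -[1%:M]sum_col_t_row_a mulmx_sumr big1 // => j _.
rewrite -scalemxAr mulmxA.
suff -> : N *m frob (q ^ j) (col_t tau) = 0 by rewrite mul0mx scaler0.
have hj : frob (q ^ j) h \in unitmx.
  by have [s _ ->] := frob_rmorph j; rewrite map_unitmx.
apply: (can_inj (mulKmx hj)); rewrite mulmx0.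
have /(congr1 (mulmx^~ (frob (q ^ j) (col_t tau)))) := S0.
rewrite mul0mx mulmx_suml (bigD1 j) //= big1 ?addr0 => [|i ij].
  rewrite -(mulmxA _ (frob _ (row_a _ _))) row_a_mul_col_t eqxx mulr1n mulmxA.
  rewrite mul_mx_scalar => /eqP.
  by rewrite scaler_eq0 (negPf (d_neq0 j)) => /eqP ->.
rewrite -(mulmxA _ (frob _ (row_a _ _))) row_a_mul_col_t (negPf ij).
by rewrite raddf0 mulmx0.
Qed.

End Twist.

(** * The planes ((X)) as a system of maximal spaces *)

Section Planes.
Variables (K : fieldType) (q : nat).
Hypothesis q_pchar : [pchar K].-nat q.
Variables (tau : K) (h : 'M[K]_3).
Hypotheses (h_unit : h \in unitmx) (h_frob3 : frob (q ^ 3) h = h).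
Hypotheses (tau_frob3 : tau ^+ (q ^ 3) = tau) (tau_frob1 : tau ^+ q != tau).

Definition twisted_plane (z : 'cV[K]_3) : {vspace 'rV[K]_9} :=
  <<[:: plane_gen q tau h 0 z; plane_gen q tau h 1 z;
        plane_gen q tau h 2 z]>>%VS.

Lemma twisted_planeP z w :
  w \in twisted_plane z <->
  exists c, w = segre_map z^T c *m segre_frame q tau h.
Proof.
rewrite mem_span3P; split=> [[e0 [e1 [e2 ->]]]|[c ->]]; last first.
  rewrite segre_map_frame // !big_ord_recl big_ord0 addr0 addrA trmxK.
  by do 3! eexists; reflexivity.
pose e (i : nat) := [:: e0; e1; e2]`_i.
have [c cE] : exists c : 'rV[K]_3,
    forall i : 'I_3, (c *m frob (q ^ i) (col_t tau)) 0 0 = e i.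
  pose d i := (frob (q ^ i) (row_a q tau) *m frob (q ^ i) (col_t tau)) 0 0.
  (* By duality the three scalars [c *m frob (q ^ i) (col_t tau)] can be prescribed freely; this is
     the interpolating row. *)
  exists (\sum_(i < 3) (e i / d i) *: frob (q ^ i) (row_a q tau)) => j.
  rewrite mulmx_suml summxE (bigD1 j) //= big1 ?addr0 => [|i ij].
    rewrite -scalemxAl mxE divfK // /d.
    rewrite row_a_mul_col_t // eqxx mxE eqxx; exact: d_neq0.
  by rewrite -scalemxAl row_a_mul_col_t // (negPf ij) !mxE mulr0.
exists c; rewrite segre_map_frame // !big_ord_recl big_ord0 addr0 addrA trmxK.
by rewrite !cE.
Qed.

Variables (B : 'M[K]_3) (lam : K).
Hypotheses (lam_neq0 : lam != 0) (hB : B *m frob q h = lam *: h).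

(** In the frame [h] the collineation is z -> z^q up to a scalar, since B h^(q) is a multiple of
    h. *)
Lemma iter_coll n z : exists2 mu, mu != 0 &
  iter n (coll q B) (h *m z) = mu *: (h *m frob (q ^ n) z).
Proof.
elim: n => [|n [mu mu0 IH]].
  by exists 1; rewrite ?oner_eq0 // scale1r frob0.
exists (mu ^+ q * lam); first by rewrite mulf_neq0 // expf_neq0.
have q1 r c (X : 'M[K]_(r, c)) : frob q X = frob (q ^ 1) X by [].
rewrite iterS IH /coll q1 frobZ frobMmx // frobD addn1 -scalemxAr mulmxA.
by rewrite -q1 hB -scalemxAl scalerA.
Qed.

Lemma frob_mxvec m (N : 'M[K]_3) :
  frob m (@mxvec K 3 3 N) = @mxvec K 3 3 (frob m N).
Proof. exact: map_mxvec. Qed.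

(** The vector [z] collects the exponent [n + m], whereas [h] and [row_a] are twisted by [m] only.
    In each form of ((X)) the exponents are chosen so that the twist of [z] disappears. *)
Lemma frob_cpow m n z : exists2 mu, mu != 0 &
  frob (q ^ m) (cpow q tau B n (h *m z))
  = mu *: plane_gen q tau h m (frob (q ^ (n + m)) z).
Proof.
have [mu mu0 E] := iter_coll n z; exists (mu ^+ (q ^ m)).
  by rewrite expf_neq0.
rewrite /cpow E gammaE -scalemxAl [mxvec _]linearZ /= frobZ frob_mxvec.
by rewrite !frobMmx // frobD.
Qed.

Hypothesis frob6 : forall x : K, x ^+ (q ^ 6) = x.

Lemma frob6_mx r c (X : 'M[K]_(r, c)) : frob (q ^ 6) X = X.
Proof. by apply/matrixP => i j; rewrite !mxE. Qed.

Lemma gamma_plane_gen z : gamma q tau (h *m z) = plane_gen q tau h 0 z.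
Proof.
by rewrite gammaE /plane_gen !frob0.
Qed.

Lemma bplaneE z : bplane q tau B (h *m z) = twisted_plane z.
Proof.
rewrite /bplane gamma_plane_gen.
(* Here 1 + 5 = 2 + 4 = 6, so [z] returns to itself. *)
have [a a0 ->] := frob_cpow 1 5 z; have [b b0 ->] := frob_cpow 2 4 z.
by rewrite !frob6_mx eq_span3.
Qed.

Lemma bplane_eE z : bplane_e q tau B (h *m z) = twisted_plane z.
Proof.
rewrite /bplane_e gamma_plane_gen -[frob q _]/(frob (q ^ 1) _) !frobD.
(* The involution contributes 3 to the twist: the totals are again 6, and the generators 4 and 5 are
   1 and 2 by periodicity. *)
have [a a0 ->] := frob_cpow 4 2 z; have [b b0 ->] := frob_cpow 5 1 z.
rewrite !frob6_mx eq_span3 //.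
by rewrite (plane_gen_add3 q_pchar h_frob3 tau_frob3 1)
           (plane_gen_add3 q_pchar h_frob3 tau_frob3 2).
Qed.

Lemma bplane_cubicE z : (forall x : K, x ^+ (q ^ 3) = x) ->
  bplane_cubic q tau B (h *m z) = twisted_plane z.
Proof.
move=> frob3; have frob3_mx : frob (q ^ 3) z = z.
  by apply/matrixP => i j; rewrite !mxE.
rewrite /bplane_cubic gamma_plane_gen.
have [a a0 ->] := frob_cpow 1 2 z; have [b b0 ->] := frob_cpow 2 1 z.
by rewrite !frob3_mx eq_span3.
Qed.

Lemma bplanes_system :
  same_elements (bplanes q tau B) (segre_system1 (segre_frame q tau h)).
Proof.
move=> U; split=> [[x x0 ->]|[u u0 UE]].
  exists (invmx h *m x)^T.
    rewrite trmx_eq0; apply: contraNneq x0 => E.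
    by rewrite -[x](mulKVmx h_unit) E mulmx0.
  move=> w; rewrite -{1}[x](mulKVmx h_unit) bplaneE; exact: twisted_planeP.
exists (h *m u^T).
  apply: contraNneq u0 => /(canRL (mulKmx h_unit)) /eqP.
  by rewrite mulmx0 trmx_eq0.
apply/vspaceP => w; rewrite bplaneE; apply/idP/idP.
  by move/UE => wE; apply/twisted_planeP; rewrite trmxK.
by move/twisted_planeP; rewrite trmxK => /UE.
Qed.

End Planes.

(** * Descent to the field with q elements and the points of V([pi]) *)

Section Subfield.
Variables (F : finFieldType) (K : fieldType) (iota : {rmorphism F -> K}).
Let q := #|F|.

Lemma pnat_pchar_card : [pchar K].-nat q.
Proof.
have [p p_pr pF] := finPcharP F.
rewrite /q (eq_pnat _ (fmorph_pchar iota)) (eq_pnat _ (pcharf_eq pF)).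
by rewrite -cardsT; apply/abelem_pgroup/fin_ring_pchar_abelem.
Qed.

(** Over [F] the polynomial X^q - X is the product of all X - y, so its roots in [K] come from
    [F]. *)
Lemma fixed_frobP (x : K) : x ^+ q = x -> exists y, iota y = x.
Proof.
move=> xq.
have /(congr1 (fun p => (map_poly iota p).[x])) := finField_genPoly F.
rewrite rmorphB /= map_polyXn map_polyX hornerD hornerN hornerXn hornerX.
rewrite xq subrr rmorph_prod horner_prod => /esym/eqP/prodf_eq0[y _].
rewrite /= rmorphB /= map_polyX map_polyC hornerXsubC subr_eq0 => /eqP ->.
by exists y.
Qed.

Lemma fixed_frob_mxP r c (X : 'M[K]_(r, c)) :
  frob q X = X -> exists Y, map_mx iota Y = X.
Proof.
move=> Xq; have /all_tag ex i : {f : 'I_c -> F | forall j, iota (f j) = X i j}.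
  have ex j : {y | iota y == X i j}.
    by apply/sigW; have [|y <-] := @fixed_frobP (X i j);
       [rewrite -{2}Xq mxE | exists y].
  by exists (fun j => sval (ex j)) => j; apply/eqP; case: (ex j).
have [f fE] := ex.
by exists (\matrix_(i, j) f i j); apply/matrixP => i j; rewrite !mxE fE.
Qed.

Lemma frob_map_mx r c (Y : 'M[F]_(r, c)) :
  frob q (map_mx iota Y) = map_mx iota Y.
Proof. by apply/matrixP => i j; rewrite !mxE -rmorphXn expf_card. Qed.

(** The unit vectors make [M] diagonal, and the all-ones vector makes its diagonal constant. *)
Lemma scalar_mx_of_eigenvectors n (M : 'M[K]_n) :
    (forall y : 'cV[F]_n, y != 0 ->
       exists m, M *m map_mx iota y = m *: map_mx iota y) ->
  exists m, M = m%:M.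
Proof.
case: n M => [|n] M eig; first by exists 0; rewrite [M]flatmx0 [RHS]flatmx0.
have /eig[m mE] : const_mx 1 != 0 :> 'cV[F]_n.+1.
  by apply/cV0Pn; exists 0; rewrite mxE oner_eq0.
exists m; apply/matrixP => i j.
have diag k l : k != l -> M k l = 0.
  have /eig[m' /matrixP/(_ k 0)] : delta_mx l 0 != 0 :> 'cV[F]_n.+1.
    by apply/cV0Pn; exists l; rewrite mxE !eqxx oner_eq0.
  rewrite map_delta_mx -colE !mxE => -> /negPf ->.
  by rewrite mulr0.
rewrite mxE; have [<-|ij] := eqVneq i j; last by rewrite diag.
have /matrixP/(_ i 0) := mE; rewrite !mxE (bigD1 i) //= big1 => [|k ki].
  by rewrite !mxE rmorph1 !mulr1 addr0.
by rewrite diag ?mul0r // eq_sym.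
Qed.

(** Every vector over [F] is an eigenvector of g^-1 B g^(q), because the collineation fixes each
    point g y of the subplane; so this matrix is scalar. *)
Lemma cpi_matrix (B : 'M[K]_3) pi g : g \in unitmx ->
    (forall P, pi P <-> exists2 y : 'cV[F]_3, y != 0 &
                          P = <[g *m map_mx iota y]>%VS) ->
    is_cpi q B pi ->
  exists2 lam, lam != 0 & B *m frob q g = lam *: g.
Proof.
move=> gU piE [BU _ fixB].
have [y y0|lam lamE] :=
  @scalar_mx_of_eigenvectors 3 (invmx g *m (B *m frob q g)).
  have /fixB fB : g *m map_mx iota y != 0.
    apply: contraNneq y0 => /(canRL (mulKmx gU)); rewrite mulmx0 => /eqP.
    by rewrite map_mx_eq0.
  have /vlineP[m mE] :
      coll q B (g *m map_mx iota y) \in <[g *m map_mx iota y]>%VS.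
    by rewrite -fB ?memv_line //; apply/piE; exists y.
  exists m; rewrite -mulmxA; apply: (canLR (mulKmx gU)).
  rewrite -scalemxAr -mE /coll -mulmxA; congr (_ *m _).
  have [s _ sE] := frob_rmorph pnat_pchar_card 1.
  have fE r c (X : 'M[K]_(r, c)) : frob q X = map_mx s X by rewrite -sE.
  by rewrite [in RHS]fE map_mxM -!fE frob_map_mx.
exists lam.
  apply: contraTneq BU => l0.
  move: lamE; rewrite l0 raddf0 => /(canRL (mulKVmx gU)); rewrite mulmx0.
  have [s _ sE] := frob_rmorph pnat_pchar_card 1.
  have fU : frob q g \in unitmx.
    by rewrite -[frob q g]/(frob (q ^ 1) g) sE map_unitmx.
  move/(canRL (mulmxK fU)); rewrite mul0mx => ->.
  by rewrite unitmxE det0 unitr0.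
by rewrite -mul_mx_scalar -lamE mulKVmx.
Qed.

Variables (tau : K) (h : 'M[K]_3).
Hypotheses (h_unit : h \in unitmx) (h_frob3 : frob (q ^ 3) h = h).
Hypotheses (tau_frob3 : tau ^+ (q ^ 3) = tau) (tau_frob1 : tau ^+ q != tau).

(** Frobenius permutes the three summands cyclically. *)
Lemma frob_segre_frame : frob q (segre_frame q tau h) = segre_frame q tau h.
Proof.
have qp := pnat_pchar_card; have [s sE frE] := frob_rmorph qp 1.
pose X := col_t tau *m row_a q tau.
pose S m : 'M[K]_9 := lin_mulmx (frob (q ^ m) h) *m lin_mulmxr (frob (q ^ m) X).
have shift m : map_mx s (S m) = S m.+1.
  rewrite map_mxM; congr (_ *m _).
    apply: (@map_lin_mx _ _ s 3 3 3 3) => A.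
    by rewrite map_mxM -[map_mx s (frob _ _)]frE frobD addn1.
  apply: (@map_lin_mx _ _ s 3 3 3 3) => A.
  by rewrite /= map_mxM -[map_mx s (frob _ _)]frE frobD addn1.
have S3 : S 3 = S 0.
  rewrite /S h_frob3 frobMmx // row_a_frob3 //.
  have [s3 s3E ->] := frob_rmorph qp 3.
  by rewrite map_col_t s3E tau_frob3 !frob0.
rewrite -[LHS]/(frob (q ^ 1) _) frE /segre_frame raddf_sum /=.
transitivity (\sum_(m < 3) S m.+1).
  by apply: eq_bigr => m _; apply: shift.
by rewrite !big_ord_recl !big_ord0 !addr0 S3 addrA addrC.
Qed.

(** For X = h y with y over [F], Frobenius fixes y, so the generators of the twisted plane are X,
    X^q, X^(q^2). Its points over [F] are then the Segre points with first factor y. *)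
Lemma VpiE (g0 : 'M[F]_9) pi :
    (forall P, pi P <-> exists2 y : 'cV[F]_3, y != 0 &
                          P = <[h *m map_mx iota y]>%VS) ->
    map_mx iota g0 = segre_frame q tau h ->
  same_elements (Vpi iota q tau pi) (segre_points g0).
Proof.
move=> piE g0E; have qp := pnat_pchar_card.
have g0U : g0 \in unitmx by rewrite -(map_unitmx iota) g0E segre_frame_unit.
have genE m y : frob (q ^ m) (gamma q tau (h *m map_mx iota y))
    = plane_gen q tau h m (map_mx iota y).
  have fy : frob (q ^ m) (map_mx iota y) = map_mx iota y.
    elim: m => [|m IH]; first exact: frob0.
    by rewrite -(addn1 m) -frobD IH; apply: frob_map_mx.
  by rewrite gammaE frob_mxvec !frobMmx // fy.
have memE y w : (w \in <<[:: gamma q tau (h *m map_mx iota y);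
     frob q (gamma q tau (h *m map_mx iota y));
     frob (q ^ 2) (gamma q tau (h *m map_mx iota y))]>>%VS) <->
    exists c, w = segre_map (map_mx iota y)^T c *m map_mx iota g0.
  rewrite g0E -twisted_planeP // /twisted_plane -!genE.
  by rewrite frob0.
move=> P; split=> [[x [x0 /piE[y y0 xE] [w w0 [PE]]]]|[u [v [u0 v0 PE]]]].
  have /vlineP[k kE] : x \in <[h *m map_mx iota y]>%VS by rewrite -xE memv_line.
  have k0 : k != 0 by apply: contraNneq x0 => k0; rewrite kE k0 scale0r.
  have -> : gamma q tau x = k *: gamma q tau (h *m map_mx iota y).
    by rewrite !gammaE kE -scalemxAl linearZ.
  rewrite -[frob q (k *: _)]/(frob (q ^ 1) _) !frobZ !span_cons.
  rewrite !vlineZ ?expf_neq0 //.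
  rewrite -!span_cons => /memE[c wE].
  (* The parameter [c] lies a priori over [K]. As y c is the image of a matrix over [F], dividing
     its row [i] by [y i 0] shows that [c] comes from [F]. *)
  have [i yi] := cV0Pn _ y0.
  pose N := unsegre (w *m invmx g0).
  have NE : map_mx iota N = map_mx iota y *m c.
    rewrite -unsegre_map map_mxM map_invmx wE mulmxK ?map_unitmx //.
    by rewrite unsegreK trmxK.
  pose v := (y i 0)^-1 *: row i N.
  have vE : map_mx iota v = c.
    rewrite map_mxZ map_row NE; apply/rowP => j.
    by rewrite !mxE big_ord1 !mxE fmorphV mulKf // fmorph_eq0.
  have wE' : w = segre_map y^T v *m g0.
    apply: (@map_mx_inj _ _ iota).
    by rewrite wE map_mxM -segre_map_map map_trmx vE.
  exists y^T, v; split; rewrite ?trmx_eq0 // -?wE' //.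
  by apply: contraNneq w0 => v0; rewrite wE' v0 linear0 mul0mx.
exists (h *m map_mx iota u^T); split.
- apply: contraNneq u0 => /(canRL (mulKmx h_unit)) /eqP.
  by rewrite mulmx0 map_mx_eq0 trmx_eq0.
- by apply/piE; exists u^T; rewrite ?trmx_eq0.
exists (segre_map u v *m g0); first exact: segre_map_neq0.
split=> //; apply/memE; exists (map_mx iota v).
by rewrite map_mxM -segre_map_map map_trmx trmxK.
Qed.

End Subfield.

(** * Independence of the chosen equations, and assembly over both extensions *)

Lemma same_elements_zero_locus_segre (F K : fieldType)
    (iota : {rmorphism F -> K}) (g g0 : 'M[F]_9) :
    g \in unitmx -> g0 \in unitmx ->
    same_elements (segre_points g0) (segre_points g) ->
  same_elements (zero_locus iota (segre_equations g))
                (segre_points (map_mx iota g0)).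
Proof.
move=> gU g0U E P; apply: iff_trans (zero_locus_segreP iota P gU) _.
by split; apply: segre_points_map_sub => // Q /E.
Qed.

Lemma primitive_root_frob_neq (K : fieldType) (q : nat) (tau : K) : (1 < q)%N ->
  (q ^ 3).-1.-primitive_root tau -> tau ^+ q != tau.
Proof.
move=> q1 prim; rewrite -{2}[tau]expr1 (eq_prim_root_expr prim).
have lt_q : (q < (q ^ 3).-1)%N.
  rewrite -ltnS prednK ?expn_gt0 ?(ltnW q1) //.
  (* The bound used is q + 2 <= 4 q <= q^3 for q >= 2. *)
  rewrite !expnS expn0 muln1 mulnA.
  apply: leq_trans (leq_mul (leq_mul q1 q1) (leqnn q)).
  rewrite -[(2 * 2)%N]/(1 + 3)%N mulnDl mul1n -(addn2 q) leq_add2l.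
  exact: leq_trans q1 (leq_pmull _ _).
by rewrite !modn_small ?(ltn_trans q1) // neq_ltn q1 orbT.
Qed.

Theorem theorem6p3 (q : nat) (F K3 K6 : finFieldType)
    (i3 : {rmorphism F -> K3}) (i6 : {rmorphism K3 -> K6})
    (hF : #|F| = q) (hK3 : #|K3| = (q ^ 3)%N) (hK6 : #|K6| = (q ^ 6)%N)
    (tau : K3) (htau : (q ^ 3).-1.-primitive_root tau)
    (pi : {vspace 'cV[K3]_3} -> Prop) (hpi : is_subplane i3 pi)
    (B : 'M[K3]_3) (hB : is_cpi q B pi) :
  (* the expressions for the planes ((X)) agree *)
  (forall x : 'cV[K6]_3, x != 0 ->
     bplane q (i6 tau) (map_mx i6 B) x = bplane_e q (i6 tau) (map_mx i6 B) x) /\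
  (forall x : 'cV[K3]_3, x != 0 -> bplane q tau B x = bplane_cubic q tau B x) /\
  (* V([pi]) is the point set of a Segre variety of PG(8, q) *)
  is_segre (Vpi i3 q tau pi) /\
  (forall g : 'M[F]_9, g \in unitmx ->
     same_elements (Vpi i3 q tau pi) (segre_points g) ->
     is_segre_with_system (zero_locus i3 (segre_equations g))
                          (bplanes q tau B) /\
     is_segre_with_system (zero_locus (i6 \o i3) (segre_equations g))
                          (bplanes q (i6 tau) (map_mx i6 B))).
Proof.
case: hpi => h hU piE; subst q; set q := #|F| in hK3 hK6 htau hB *.
have [lam lam0 hlam] := cpi_matrix hU piE hB.
have p3 : [pchar K3].-nat q := pnat_pchar_card i3.
have p6 : [pchar K6].-nat q := pnat_pchar_card (i6 \o i3).
have frob3 (x : K3) : x ^+ (q ^ 3) = x by rewrite -hK3 expf_card.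
(* The form of ((X)) with exponents summing to 6 is thus also valid over [K3]. *)
have frob63 (x : K3) : x ^+ (q ^ 6) = x.
  by rewrite (_ : 6 = 3 + 3)%N // expnD exprM !frob3.
have frob66 (x : K6) : x ^+ (q ^ 6) = x by rewrite -hK6 expf_card.
have h3 : frob (q ^ 3) h = h by apply/matrixP => i j; rewrite !mxE.
have tau1 : tau ^+ q != tau.
  by apply: primitive_root_frob_neq htau; apply: finNzRing_gt1.
pose h6 := map_mx i6 h; pose tau6 := i6 tau.
have h6U : h6 \in unitmx by rewrite map_unitmx.
have h63 : frob (q ^ 3) h6 = h6 by rewrite -map_frob h3.
have tau63 : tau6 ^+ (q ^ 3) = tau6 by rewrite -rmorphXn frob3.
have tau61 : tau6 ^+ q != tau6 by rewrite -rmorphXn fmorph_eq.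
have lam60 : i6 lam != 0 by rewrite fmorph_eq0.
have hlam6 : map_mx i6 B *m frob q h6 = i6 lam *: h6.
  by rewrite -map_frob -map_mxM hlam map_mxZ.
(* A single matrix [g0] over [F] gives the trace matrices over both [K3] and [K6]. *)
have [g0 g0E] := fixed_frob_mxP i3 (frob_segre_frame i3 h3 (frob3 tau)).
have g0E6 : map_mx (i6 \o i3) g0 = segre_frame q tau6 h6.
  by rewrite map_mx_comp g0E map_segre_frame.
have frameU := segre_frame_unit p3 hU (frob3 tau) tau1.
have frame6U := segre_frame_unit p6 h6U tau63 tau61.
have g0U : g0 \in unitmx by rewrite -(map_unitmx i3) g0E.
have VE := VpiE hU (frob3 tau) tau1 piE g0E.
split=> [x _|].
  rewrite -[x](mulKVmx h6U) (bplaneE p6 _ lam60 hlam6) //.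
  by rewrite (bplane_eE p6 h63 _ lam60 hlam6).
split=> [x _|].
  rewrite -[x](mulKVmx hU) (bplaneE p3 _ lam0 hlam) //.
  by rewrite (bplane_cubicE p3 _ lam0 hlam).
split; first by exists g0.
move=> g gU VgE.
have E : same_elements (segre_points g0) (segre_points g).
  by move=> P; apply: iff_trans (iff_sym (VE P)) (VgE P).
split.
  exists (segre_frame q tau h) => //; split.
    by rewrite -g0E; apply: same_elements_zero_locus_segre.
  by left; apply: bplanes_system lam0 hlam _.
exists (segre_frame q tau6 h6) => //; split.
  by rewrite -g0E6; apply: same_elements_zero_locus_segre.
by left; apply: bplanes_system lam60 hlam6 _.
Qed.
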